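(* Any pre-sturmian infinite word $w\in\{0,1\}^{\mathbb{N}}$ of order $k$ is renormalizable in the following way: there are two words $a$ and $b$ belonging to $\{0,1\}^*$ with distinct first letters and a positive integer $s$ such that $$|a|\ge |b|,\qquad (s+1)|a|+|b|>k,$$ and some iterate of $w$ under the one-sided shift $T$ belongs to $\{a,ba^s\}^{\mathbb{N}}$.
   Context: $\mathbb{N}$ denotes the set of non-negative integers, $\{0,1\}^*$ the set of finite words and $\{0,1\}^{\mathbb{N}}$ the set of infinite words on the alphabet $\{0,1\}$. For an infinite word $w$ and $n\in\mathbb{N}$, $p_w(n)$ is the number of distinct words of length $n$ that are factors of $w$ (occur as blocks of $n$ consecutive letters of $w$). A word $w\in\{0,1\}^{\mathbb{N}}$ is a pre-sturmian infinite word of order $k$ if $w$ is not ultimately periodic and if, for any non-negative integer $n\le k$, $p_w(n)=n+1$. $|v|$ is the length of a finite word $v$; $a^s$ is the concatenation of $s$ copies of $a$, and $ba^s$ is the concatenation of $b$ and $a^s$. $T$ is the one-sided shift, which deletes the first letter of an infinite word. For a set $\Sigma$ of finite words, $\Sigma^{\mathbb{N}}$ denotes the set of infinite words obtained by concatenating elements of $\Sigma$.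
   Formalization: The order k is assumed to be at least 2; for k = 0 or 1 the claim fails, since 0 1 00 11 000 111 … is pre-sturmian of these orders, but an iterate in {a, ba^s}^N would have bounded runs of one letter. *)

(* Defs.v *)
From mathcomp Require Import all_boot.
From mathcomp Require Import boolp.

Set Implicit Arguments.
Unset Strict Implicit.
Unset Printing Implicit Defensive.

Definition word := seq bool.
Definition infword := nat -> bool.

Definition block (w : infword) (i n : nat) : word :=
  mkseq (fun j => w (i + j)) n.

Definition factor (u : word) (w : infword) : Prop :=
  exists i, u = block w i (size u).

Definition complexity (w : infword) (n : nat) : nat :=
  #|[set u : n.-tuple bool | `[< factor u w >]]|.

Definition ultimately_periodic (w : infword) : Prop :=
  exists N p, 0 < p /\ forall n, N <= n -> w (n + p) = w n.

(* Orders 0 and 1 carry no information: every word that is not ultimately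
   periodic is pre-sturmian of order 1.  Renormalization {a, b a^s}^N bounds the
   runs of one letter, so it can hold for all such words only from order 2 on. *)
Definition pre_sturmian (k : nat) (w : infword) : Prop :=
  ~ ultimately_periodic w /\ forall n, n <= k -> complexity w n = n.+1.

Definition power (a : word) (s : nat) : word := flatten (nseq s a).

Definition shift (w : infword) : infword := fun n => w n.+1.

(* In particular both words are nonempty. *)
Definition distinct_first_letters (a b : word) : bool :=
  match a, b with
  | x :: _, y :: _ => x != y
  | _, _ => false
  end.

(* [w] belongs to Sigma^N.  The unboundedness clause makes the concatenation
   an infinite word even when the empty word belongs to Sigma. *)
Definition concatenation_of (Sigma : pred word) (w : infword) : Prop :=
  exists u : nat -> word,
    [/\ forall i, Sigma (u i),
        forall l, exists m, l <= size (flatten (mkseq u m))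
      & forall m, flatten (mkseq u m) = block w 0 (size (flatten (mkseq u m)))].

(* Main.v *)
Require Import Defs.
From mathcomp Require Import all_boot.
From mathcomp Require Import boolp zify.

(** A Euclidean algorithm on pairs of words.  Suppose that a tail of [w] is a
    concatenation of two words [x] and [y] with distinct first letters.  If [y]
    is never followed by [y], then every [y] can be glued to the [x] after it,
    and a further tail is a concatenation of [x] and [yx]; symmetrically, if [x]
    is never followed by [x], a tail is a concatenation of [y] and [xy].

    One of the two cases occurs as long as [|x| + |y| <= k].  The reason is that
    the pair carries two distinct markers [v] and [u], both of length
    [|x| + |y| - 1], such that [w] has just displayed [v] whenever it has read
    an [x], and [u] whenever it has read a [y].  If all of [xx], [xy], [yx], [yy]
    occurred, both markers could be followed by the first letter of [x] and by
    that of [y], so they would be two right special factors of the same length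
    [m < k] ([complexity_right_special]), which forces [p(m+1) >= p(m) + 2].
    Markers survive gluing: in the new concatenation [x] comes after an [x],
    so that [vx] is displayed once it is read, while [ux] is displayed once [yx]
    is read; [vx] and [ux] are distinct and longer than [v] and [u] by [|x|], as
    they should be.

    The algorithm starts from the two letters, with the letters as markers, and
    the total length increases at each step until it exceeds [k].  After the
    first step the pair has the form [{a, b a^s}] with [s > 0] and
    [|b| <= |a|]: gluing [b a^s] to [a] replaces [s] by [s + 1], and gluing [a]
    to [b a^s] gives the pair [{a', b' a'}] with [a' = b a^s] and [b' = a].  The
    total length is [(s+1)|a| + |b|], whence the bound. *)

Set Implicit Arguments.
Unset Strict Implicit.
Unset Printing Implicit Defensive.

(** * Occurrences of finite words *)

Definition occurs (w : infword) (z : word) (p : nat) : Prop :=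
  block w p (size z) = z.

Definition ends_at (w : infword) (t : word) (q : nat) : Prop :=
  exists2 p, q = p + size t & occurs w t p.

Lemma size_block w p n : size (block w p n) = n.
Proof. exact: size_mkseq. Qed.

Lemma block_cat w p m n : block w p (m + n) = block w p m ++ block w (p + m) n.
Proof.
rewrite /block /mkseq iotaD map_cat add0n; congr (_ ++ _).
rewrite -[m in iota m]addn0 iotaDl -map_comp.
by apply: eq_map => j /=; rewrite addnA.
Qed.

Lemma occurs_cat w s t p :
  occurs w (s ++ t) p <-> occurs w s p /\ occurs w t (p + size s).
Proof.
rewrite /occurs size_cat block_cat; split=> [e|[-> ->] //].
have: (block w p (size s) == s) && (block w (p + size s) (size t) == t).
  by rewrite -eqseq_cat ?size_block // e.
by case/andP=> /eqP -> /eqP ->.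
Qed.

Lemma occurs_factor w z p : occurs w z p -> factor z w.
Proof. by move=> h; exists p. Qed.

Lemma ends_at_cat w t z q :
  ends_at w t q -> occurs w z q -> ends_at w (t ++ z) (q + size z).
Proof.
case=> p -> ht hz; exists p; first by rewrite size_cat addnA.
exact/occurs_cat.
Qed.

Lemma ends_at_factor w t x z q :
  ends_at w t q -> occurs w (x :: z) q -> factor (rcons t x) w.
Proof.
move=> ht; rewrite -cat1s => /occurs_cat[hx _].
have [p _] := ends_at_cat ht hx.
by rewrite cats1; apply: occurs_factor.
Qed.

(** * Right special factors and periodicity *)

(** Deleting the last letter maps factors of length [m+1] onto factors of length
    [m].  If [S c] is the set of those that [c] may follow, then
    [p(m)] is the size of the union of [S false] and [S true], and [p(m+1)] the
    sum of their sizes.  The difference is the size of their intersection, the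
    set of right special factors, which contains [u] and [v]. *)
Lemma complexity_right_special w m (u v : word) :
  size u = m -> size v = m -> u <> v ->
  (forall c, factor (rcons u c) w /\ factor (rcons v c) w) ->
  complexity w m + 2 <= complexity w m.+1.
Proof.
move=> su sv uv huv; rewrite /complexity.
pose F n := [set t : n.-tuple bool | `[< factor t w >]].
pose S c := [set t : m.-tuple bool | `[< factor (rcons t c) w >]].
have FE : F m = S false :|: S true.
  apply/setP => t; rewrite !inE; apply/asboolP/orP.
    case=> i; rewrite size_tuple => e.
    have: factor (rcons t (w (i + m))) w.
      apply: (@occurs_factor w _ i); rewrite -cats1; apply/occurs_cat.
      by rewrite /occurs size_tuple -e /block /mkseq /= addn0.
    by case: (w _) => h; [right|left]; apply/asboolP.
  case=> /asboolP[i]; rewrite -cats1 => /esym/occurs_cat[h _];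
    exact: occurs_factor h.
pose R c (t : m.-tuple bool) : m.+1.-tuple bool := [tuple of rcons t c].
have inj c : injective (R c).
  by move=> s t /(congr1 val)/= /rcons_inj[/val_inj].
have FS : F m.+1 = R false @: S false :|: R true @: S true.
  apply/setP => t; rewrite !inE; apply/asboolP/orP.
    have [s [c ->]] : exists (s : m.-tuple bool) c, t = R c s.
      case: t => t; case/lastP: t => [//|t c] st.
      have st' : size t == m by rewrite size_rcons eqSS in st.
      by exists (Tuple st'), c; apply: val_inj.
    by case: c => h; [right|left]; apply/imsetP; exists s; rewrite ?inE //;
      apply/asboolP.
  by case=> /imsetP[s]; rewrite inE => /asboolP h ->.
rewrite -/(F m) -/(F m.+1) FE FS.
have -> : #|R false @: S false :|: R true @: S true|
       = #|S false| + #|S true|.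
  rewrite cardsU !card_imset //.
  rewrite (_ : _ :&: _ = set0) ?cards0 ?subn0 //.
  apply/setP => t; rewrite !inE; apply/andP => -[/imsetP[s _ ->] /imsetP[s' _]].
  by move=> /(congr1 val)/= /rcons_inj[].
rewrite -cardsUI leq_add2l.
pose u' : m.-tuple bool := tcast su (in_tuple u).
pose v' : m.-tuple bool := tcast sv (in_tuple v).
have u'E : u' = u :> seq bool by rewrite val_tcast.
have v'E : v' = v :> seq bool by rewrite val_tcast.
have -> : 2 = #|[set u'; v']|.
  by rewrite cards2; case: eqP => // e; case: uv; rewrite -u'E -v'E e.
apply/subset_leq_card/subsetP => t; rewrite !inE.
by case/orP=> /eqP ->; rewrite ?u'E ?v'E; apply/andP; split; apply/asboolP;
  apply huv.
Qed.

(** This is how the hypothesis that [w] is not ultimately periodic is used: no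
    single word can be read forever, so both words of a pair come back. *)
Lemma ultimately_periodic_repeat w x (D : nat -> Prop) p0 :
  0 < size x -> D p0 ->
  (forall p, D p -> occurs w x p /\ D (p + size x)) -> ultimately_periodic w.
Proof.
move=> x0 D0 Dx; exists p0, (size x); split=> // n le_n.
have hD j : D (p0 + j * size x).
  by elim: j => [|j IH]; rewrite ?addn0 // mulSnr addnA; apply: (Dx _ IH).2.
have hw j i : i < size x -> w (p0 + j * size x + i) = nth false x i.
  move=> lt_i; have [h _] := Dx _ (hD j).
  by rewrite -[in RHS]h nth_mkseq.
rewrite -(subnKC le_n) (divn_eq (n - p0) (size x)).
have lt := ltn_pmod (n - p0) x0.
rewrite addnA hw // -[RHS](hw ((n - p0) %/ size x).+1) //.
by congr (w _); rewrite mulSnr; lia.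
Qed.

(** * Parsing a tail by two marked words *)

Definition reads w (C : nat -> Prop) z t p :=
  [/\ occurs w z p, C (p + size z) & ends_at w t (p + size z)].

(** A tail of [w] is a concatenation of [x] and [y] when some nonempty set [C] of
    positions, the cuts, is stable under reading one of them.  Describing the
    concatenation by a stable set makes regrouping easy: it suffices to keep
    fewer cuts, with no sequence of words to reindex.  The words [v] and [u] are
    the markers seen after [x] and after [y]. *)
Definition parsing w x y v u (C : nat -> Prop) :=
  (exists p, C p) /\ forall p, C p -> reads w C x v p \/ reads w C y u p.

(** The length [m] of the markers satisfies [m + 1 = size x + size y], so that
    [size x + size y <= k] gives the complexities at [m] and [m + 1]. *)
Definition parses w x y :=
  distinct_first_letters x y /\
  exists C v u,
    [/\ parsing w x y v u C, (size v).+1 = size x + size y,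
        size u = size v & v <> u].

Lemma parsingC w x y v u C : parsing w x y v u C -> parsing w y x u v C.
Proof. by case=> h0 h; split=> // p /h [] ?; [right|left]. Qed.

Lemma distinct_first_lettersC x y :
  distinct_first_letters x y = distinct_first_letters y x.
Proof. by case: x y => [|? ?] [|? ?] //=; rewrite eq_sym. Qed.

Lemma distinct_first_letters_catr x y z :
  distinct_first_letters x y -> distinct_first_letters x (y ++ z).
Proof. by case: x y => [|? ?] [|? ?]. Qed.

Lemma distinct_first_letters_gt0 x y :
  distinct_first_letters x y -> 0 < size x /\ 0 < size y.
Proof. by case: x y => [|? ?] [|? ?]. Qed.

Lemma parsesC w x y : parses w x y -> parses w y x.
Proof.
case=> dxy [C [v [u [hC sv su vu]]]].
split; first by rewrite distinct_first_lettersC.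
exists C, u, v; split; [exact: parsingC | by rewrite su sv addnC | by [] |].
by move/esym.
Qed.

Lemma parsing_reads w x y v u C :
  ~ ultimately_periodic w -> 0 < size y -> parsing w x y v u C ->
  exists2 p, C p & reads w C x v p.
Proof.
move=> aper y0 [[p0 C0] hC]; apply: contrapT => no.
apply: aper; apply: (ultimately_periodic_repeat y0 C0) => p Cp.
case: (hC p Cp) => [h|[]//]; by case: no; exists p.
Qed.

Lemma parsing_switch w x y v u C :
  ~ ultimately_periodic w -> 0 < size x -> 0 < size y -> parsing w x y v u C ->
  exists2 p, reads w C x v p & occurs w y (p + size x).
Proof.
move=> aper x0 y0 hC; apply: contrapT => no.
have [p0 _ r0] := parsing_reads aper y0 hC.
apply: aper; apply: (ultimately_periodic_repeat x0 r0) => p r.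
have [hx Cx _] := r; split=> //.
case: (hC.2 _ Cx) => [//|[hy _ _]]; by case: no; exists p.
Qed.

(** The new cuts are the old ones that follow an [x].  Both [x] and [yx] end with
    [x], so reading leads from such a cut to another; and the new markers are
    obtained by prolonging the old ones by the last [x] read. *)
Lemma parsing_group w x y v u C :
  ~ ultimately_periodic w -> 0 < size y -> parsing w x y v u C ->
  (forall p, reads w C y u p -> ~ occurs w y (p + size y)) ->
  exists C', parsing w x (y ++ x) (v ++ x) (u ++ x) C'.
Proof.
move=> aper y0 hC noyy.
exists (fun p => exists2 r, p = r + size x & reads w C x v r); split.
  by have [p _ h] := parsing_reads aper y0 hC; exists (p + size x), p.
move=> _ [r -> [_ Cp ev]].
case: (hC.2 _ Cp) => [rx|ry].
  left; have [ox _ _] := rx; split=> //; last exact: ends_at_cat.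
  by exists (r + size x).
have [oy Cy eu] := ry.
case: (hC.2 _ Cy) => [rx|[yy _ _]]; last by case: (noyy _ ry).
right; have [ox _ _] := rx; rewrite /reads size_cat addnA; split.
- exact/occurs_cat.
- by exists (r + size x + size y).
- exact: ends_at_cat.
Qed.

Lemma parses_group w x y v u C :
  ~ ultimately_periodic w -> distinct_first_letters x y ->
  parsing w x y v u C -> (size v).+1 = size x + size y -> size u = size v ->
  v <> u ->
  (forall p, reads w C y u p -> ~ occurs w y (p + size y)) ->
  parses w x (y ++ x).
Proof.
move=> aper dxy hC sv su vu noyy.
have [_ y0] := distinct_first_letters_gt0 dxy.
have [C' hC'] := parsing_group aper y0 hC noyy.
split; first exact: distinct_first_letters_catr.
exists C', (v ++ x), (u ++ x); split; rewrite ?size_cat //; try lia.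
by move/eqP; rewrite eqseq_cat // eqxx andbT => /eqP.
Qed.

(** If both [xx] and [yy] occurred, so would [xy] and [yx], since neither word is
    repeated forever; the two markers would then be right special. *)
Lemma parses_step k w x y :
  pre_sturmian k w -> size x + size y <= k -> parses w x y ->
  parses w x (y ++ x) \/ parses w y (x ++ y).
Proof.
case=> aper hk le_k [dxy [C [v [u [hC sv su vu]]]]].
have [noyy|/existsNP[p /not_implyP[ryy /contrapT oyy]]] :=
  pselect (forall p, reads w C y u p -> ~ occurs w y (p + size y)).
  by left; apply: (parses_group aper dxy hC).
have [noxx|/existsNP[q /not_implyP[rxx /contrapT oxx]]] :=
  pselect (forall p, reads w C x v p -> ~ occurs w x (p + size x)).
  right; apply: (parses_group aper _ (parsingC hC)) => //.
  - by rewrite distinct_first_lettersC.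
  - by rewrite su sv addnC.
  - by move/esym.
exfalso.
have two (c c0 c1 : bool) : c0 != c1 -> c = c0 \/ c = c1.
  by case: c c0 c1 => [] [] []; auto.
have [x0 y0] := distinct_first_letters_gt0 dxy.
have [r rxy oxy] := parsing_switch aper x0 y0 hC.
have [t ryx oyx] := parsing_switch aper y0 x0 (parsingC hC).
(* Both [size v] and [(size v).+1 = size x + size y] are at most [k]. *)
have := @complexity_right_special w (size v) v u erefl su vu.
rewrite !hk ?sv //; last by rewrite -ltnS sv ltnW.
suff h c : factor (rcons v c) w /\ factor (rcons u c) w.
  by move=> /(_ h); lia.
have [_ _ euyy] := ryy; have [_ _ evxx] := rxx.
have [_ _ evxy] := rxy; have [_ _ euyx] := ryx.
case: x y dxy {hC sv le_k x0 y0 rxx ryy rxy ryx}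
  oyy oxx oxy oyx euyy evxx evxy euyx => [|c0 x] [|c1 y] //= c01
  oyy oxx oxy oyx euyy evxx evxy euyx.
have [->|->] := two c c0 c1 c01.
  by split; [apply: ends_at_factor evxx oxx | apply: ends_at_factor euyx oyx].
by split; [apply: ends_at_factor evxy oxy | apply: ends_at_factor euyy oyy].
Qed.

(** * Renormalization *)

Lemma parses_letters w : parses w [:: false] [:: true].
Proof.
split=> //; exists (fun=> True), [:: false], [:: true]; split=> //.
split=> [|p _]; first by exists 0.
case e: (w p); [right|left]; split=> //; try (exists p => //);
  by rewrite /occurs /block /mkseq /= addn0 e.
Qed.

Lemma powerSr a s : power a s.+1 = power a s ++ a.
Proof. by rewrite /power -addn1 nseqD flatten_cat /= cats0. Qed.

Lemma size_power a s : size (power a s) = s * size a.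
Proof. by elim: s => [//|s IH]; rewrite powerSr size_cat IH mulSnr. Qed.

Lemma iter_shift n w i : iter n shift w i = w (n + i).
Proof. by elim: n i => [//|n IH] i; rewrite iterS /shift IH addnS. Qed.

Lemma concatenation_of_parses w x y :
  parses w x y -> exists n, concatenation_of (pred2 x y) (iter n shift w).
Proof.
case=> dxy [C [v [u [[[n Cn] hC] _ _ _]]]].
have [x0 y0] := distinct_first_letters_gt0 dxy.
pose z p := if pselect (reads w C x v p) then x else y.
have zP p : C p -> occurs w (z p) p /\ C (p + size (z p)).
  by move=> /hC; rewrite /z; case: pselect => [[]//|nr [//|[]//]].
pose q i := iter i (fun p => p + size (z p)) n.
have Cq i : C (q i) by elim: i => [//|i IH]; apply: (zP _ IH).2.
pose F m := flatten (mkseq (z \o q) m).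
have FS m : F m.+1 = F m ++ z (q m).
  by rewrite /F /mkseq -[m.+1]addn1 iotaD map_cat flatten_cat /= cats0.
have qE m : q m = n + size (F m).
  by elim: m => [|m IH]; rewrite ?addn0 // FS size_cat addnA -IH.
exists n, (z \o q); split.
- by move=> i; rewrite /= /z; case: pselect => ? /=; rewrite eqxx ?orbT.
- move=> l; exists l; rewrite -/(F l); elim: l => [//|l IH].
  rewrite FS size_cat -addn1 leq_add //.
  by rewrite /z; case: pselect.
- move=> m; rewrite -/(F m).
  have: occurs w (F m) n.
    elim: m => [//|m IH]; rewrite FS; apply/occurs_cat; split=> //.
    by rewrite -qE; apply: (zP _ (Cq m)).1.
  move=> {1}<-; apply: eq_map => j /=.
  by rewrite iter_shift add0n.
Qed.

(** Gluing keeps the form [{a, b a^s}] of the pair, and the hypothesis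
    [size b <= size a] is preserved when the pair becomes [{b a^s, a (b a^s)}]
    because [s > 0]. *)
Lemma renormalization k w a b s :
  pre_sturmian k w -> distinct_first_letters a b -> 0 < s ->
  size b <= size a -> parses w a (b ++ power a s) ->
  exists (a b : word) (s : nat),
    [/\ distinct_first_letters a b, 0 < s, size b <= size a,
        k < s.+1 * size a + size b & parses w a (b ++ power a s)].
Proof.
(* With [k] instead of [k.+1] the measure would not decrease when the total
   length equals [k]. *)
move=> hw; have [d] := ubnP (k.+1 - (s.+1 * size a + size b)).
elim: d a b s => // d IH a b s lt_d dab s0 le_ba hp.
have [lt_k|le_k] := ltnP k (s.+1 * size a + size b); first by exists a, b, s.
have [a0 b0] := distinct_first_letters_gt0 dab.
have [|h|h] := parses_step hw _ hp.
- by rewrite size_cat size_power; lia.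
- apply: (IH a b s.+1) => //; first by lia.
  by rewrite powerSr catA.
- apply: (IH (b ++ power a s) a 1) => //.
  + by rewrite size_cat size_power; nia.
  + by rewrite distinct_first_lettersC; apply: distinct_first_letters_catr.
  + by rewrite size_cat size_power; nia.
  + by rewrite /power /= cats0.
Qed.

Theorem theorem3p2 (k : nat) (w : infword) (hk : 2 <= k)
    (hw : pre_sturmian k w) :
  exists (a b : word) (s : nat),
    [/\ distinct_first_letters a b,
        0 < s,
        size b <= size a,
        k < s.+1 * size a + size b
      & exists n, concatenation_of (pred2 a (b ++ power a s)) (iter n shift w)].
Proof.
suff: exists (a b : word) (s : nat),
    [/\ distinct_first_letters a b, 0 < s, size b <= size a,
        k < s.+1 * size a + size b & parses w a (b ++ power a s)].
  case=> a [b [s [dab s0 le_ba lt_k hp]]]; exists a, b, s; split=> //.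
  exact: concatenation_of_parses.
(* The pair of letters has the form [{a, b a^s}] for [s = 0] only; one step, made
   possible by [2 <= k], brings it to [s = 1]. *)
have [//|h|h] := parses_step hw _ (parses_letters w).
  exact: (@renormalization k w [:: false] [:: true] 1).
exact: (@renormalization k w [:: true] [:: false] 1).
Qed.
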